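(* Let $n\ge 2$, $\varepsilon\in(0,1)$ and $\delta\in(0,1)$. In the batch setting, any $\delta$-correct algorithm for testing identity to the uniform distribution $U_n$ (i.e. distinguishing $H_1:\mathcal{D}'=U_n$ from $H_2:\mathrm{TV}(\mathcal{D}',U_n)>\varepsilon$) must use a number $\tau$ of samples satisfying $$\tau\ \ge\ \max_{b\in[n]}\min\left\{\frac{\log(1/\delta)}{\mathrm{kl}(b/n+\varepsilon/2,\,b/n+\varepsilon)},\ \frac{\log(1/\delta)}{\mathrm{kl}(b/n+\varepsilon/2,\,b/n)}\right\}-\mathcal{O}\left(\frac{n\log\log(1/\delta)}{\varepsilon^2}\right),$$ where $\mathcal{O}$ hides a universal constant.
   Context: $[n]=\{1,\dots,n\}$, $U_n$ is the uniform distribution on $[n]$, and $\mathrm{TV}(\mathcal{D},\mathcal{D}')=\frac12\sum_{i=1}^n|\mathcal{D}_i-\mathcal{D}'_i|$. For $p,q\in[0,1]$, $\mathrm{kl}(p,q)=p\log\frac pq+(1-p)\log\frac{1-p}{1-q}$ is the Kullback–Leibler divergence between Bernoulli$(p)$ and Bernoulli$(q)$. A batch algorithm fixes a number $\tau$ (depending only on $n,\varepsilon,\delta$) in advance, observes $\tau$ i.i.d. samples from the unknown distribution $\mathcal{D}'$ on $[n]$, and outputs $H_1$ or $H_2$; it is $\delta$-correct if it outputs $H_2$ with probability at most $\delta$ when $\mathcal{D}'=U_n$, and outputs $H_1$ with probability at most $\delta$ whenever $\mathrm{TV}(\mathcal{D}',U_n)>\varepsilon$.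
   Formalization: In the remainder, log log(1/δ) is replaced by max(1, log log(1/δ)), since the bound fails at δ = 1/e (n = 2, ε = 1/4, 25 samples suffice), and the maximum over b is restricted to b/n + ε ≤ 1, where both divergences are defined. *)

(* Defs.v *)
(* MathComp / MathComp-Analysis *)
From mathcomp Require Import all_boot all_order all_algebra.
From mathcomp Require Import all_classical all_reals all_analysis.
Set Implicit Arguments.
Unset Strict Implicit.
Unset Printing Implicit Defensive.
Import Order.TTheory GRing.Theory Num.Theory.
Local Open Scope ring_scope.

(* The sample space [n] = {1, ..., n} is encoded as 'I_n = {0, ..., n-1}. *)
Definition is_distr (R : realType) (n : nat) (D : 'I_n -> R) : Prop :=
  (forall i, 0 <= D i) /\ \sum_(i < n) D i = 1.

Definition uniform (R : realType) (n : nat) : 'I_n -> R := fun=> n%:R^-1.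

Definition TV (R : realType) (n : nat) (D D' : 'I_n -> R) : R :=
  2^-1 * \sum_(i < n) `|D i - D' i|.

(* The summand p * log (p / q) of a Kullback-Leibler divergence, with the usual
   conventions 0 * log (0 / q) = 0 and p * log (p / 0) = +oo for p > 0. *)
Definition kl_term (R : realType) (p q : R) : \bar R :=
  if p == 0 then 0%E else if q == 0 then +oo%E else (p * ln (p / q))%:E.

Definition kl (R : realType) (p q : R) : \bar R :=
  (kl_term p q + kl_term (1 - p) (1 - q))%E.

(* A batch algorithm may use internal randomness: [reject s] is the conditional
   probability that it outputs H2 (and [1 - reject s] that it outputs H1) given
   the observed sample [s]. Deterministic algorithms are those for which
   [reject] takes only the values 0 and 1. *)
Record batch_algorithm (R : realType) (n : nat) := BatchAlgorithm {
  nb_samples : nat;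
  reject : {ffun 'I_nb_samples -> 'I_n} -> R;
  reject_bound : forall s, 0 <= reject s <= 1
}.

Definition iid_law (R : realType) (n tau : nat) (D : 'I_n -> R)
    (s : {ffun 'I_tau -> 'I_n}) : R :=
  \prod_(t < tau) D (s t).

Definition prob_H2 (R : realType) (n : nat) (A : batch_algorithm R n)
    (D : 'I_n -> R) : R :=
  \sum_(s : {ffun 'I_(nb_samples A) -> 'I_n}) iid_law D s * reject s.

Definition prob_H1 (R : realType) (n : nat) (A : batch_algorithm R n)
    (D : 'I_n -> R) : R :=
  \sum_(s : {ffun 'I_(nb_samples A) -> 'I_n}) iid_law D s * (1 - reject s).

Definition delta_correct (R : realType) (n : nat) (eps delta : R)
    (A : batch_algorithm R n) : Prop :=
  prob_H2 A (@uniform R n) <= delta /\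
  (forall D' : 'I_n -> R, is_distr D' ->
     eps < TV D' (@uniform R n) -> prob_H1 A D' <= delta).

(* max_{b in [n]} min {log(1/delta) / kl(b/n + eps/2, b/n + eps),
                       log(1/delta) / kl(b/n + eps/2, b/n)}.
   The maximum runs over the b for which both divergences are defined, i.e.
   b/n + eps <= 1; it is -oo if there is none. If b/n + eps = 1, the first
   divergence is +oo and the corresponding quotient is 0. *)
Definition main_term (R : realType) (n : nat) (eps delta : R) : \bar R :=
  \big[maxe/-oo%E]_(1 <= b < n.+1 | b%:R / n%:R + eps <= 1)
    mine ((ln delta^-1)%:E / kl (b%:R / n%:R + eps / 2) (b%:R / n%:R + eps))%E
         ((ln delta^-1)%:E / kl (b%:R / n%:R + eps / 2) (b%:R / n%:R))%E.

(* The argument n * log log (1/delta) / eps^2 of the O(.) remainder. The iterated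
   logarithm is truncated from below at 1, because log log (1/delta) vanishes at
   delta = 1/e and is negative for delta > 1/e; for delta <= exp (- e) the
   truncation has no effect. *)
Definition remainder (R : realType) (n : nat) (eps delta : R) : R :=
  n%:R * Num.max 1 (ln (ln delta^-1)) / eps ^+ 2.

(* Main.v *)
(* Fix b, put p = b/n, x = p + eps/2, q = p + eps < 1, and for y in (0,1) let D_y
   give total mass y to the first b points, uniformly, and 1 - y to the others,
   uniformly; D_p is U_n and TV(D_q, U_n) = eps. Correctness at U_n and at D_q' for
   q' slightly above q forces sum_s min(D_p(s), D_q(s)) <= 3 delta. Changing measure
   to D_x, on samples with N points in the first block the minimum is at least
   D_x(s) exp(- tau K - a |N - tau x|), where K is the larger of kl(x,p) and kl(x,q)
   and the slope a of the log-likelihood ratios is O(n K / eps).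

   Restricting to |N - tau x| = O(1/eps) costs O(n K / eps^2) in the exponent. Under
   D_x, N is binomial, and by Chebyshev and unimodality this window has probability
   of order 1 / (1 + eps sqrt tau) at least. Since K >= eps^2/16 and one may assume
   tau K <= log(1/delta), the window costs only a factor sqrt(log(1/delta)): a larger
   window would lose sqrt(log(1/delta)) in the exponent, and a single value of N
   would lose log(1/eps). *)
Require Import Defs.
From mathcomp Require Import all_boot all_order all_algebra.
From mathcomp Require Import all_classical all_reals all_analysis.
From mathcomp Require Import ring lra zify.
Set Implicit Arguments.
Unset Strict Implicit.
Unset Printing Implicit Defensive.
Import Order.TTheory GRing.Theory Num.Theory.
Local Open Scope ring_scope.

(** * Centered window sums of unimodal sequences *)

Section UnimodalSums.
Variables (R : realFieldType) (f : nat -> R) (a : nat).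
Hypothesis f_ge0 : forall k, 0 <= f k.
Hypothesis f_incr : forall k, (k < a)%N -> f k <= f k.+1.
Hypothesis f_decr : forall k, (a <= k)%N -> f k.+1 <= f k.

(** The guard matters because natural subtraction is truncated: without it every [j >= a] would
    count [f 0] once more. *)
Let pair j := f (a + j)%N + (if (j < a)%N then f (a - j.+1)%N else 0).

Let pair_ge0 j : 0 <= pair j.
Proof. by rewrite /pair addr_ge0//; case: ifP. Qed.

Let pair_decr i j : (i <= j)%N -> pair j <= pair i.
Proof.
move=> /subnK <-; elim: (j - i)%N => [|d IH]//; apply: le_trans IH.
rewrite addSn /pair lerD// ?addnS ?f_decr ?leq_addr//.
case: ifP => h1; last by case: ifP.
rewrite (ltn_trans _ h1)//.
have -> : (a - (d + i).+1 = (a - (d + i).+2).+1)%N by lia.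
by rewrite f_incr//; lia.
Qed.

(* The two terms at distance about [j] from the mode, added up, form a nonincreasing
   sequence in [j], which replaces the two-sided monotonicity of [f]. *)
Lemma centered_sumE w : \sum_(a - w <= k < a + w) f k = \sum_(j < w) pair j.
Proof.
elim: w => [|w IH]; first by rewrite subn0 addn0 big_geq// big_ord0.
rewrite big_ord_recr/= -IH addnS big_nat_recr/=; last by lia.
rewrite /pair; case: ltnP => h.
  rewrite big_ltn; last by lia.
  have -> : (a - w.+1).+1 = (a - w)%N by lia.
  ring.
have -> : (a - w.+1 = a - w)%N by lia.
by rewrite addr0.
Qed.

(** Widening the window from [w] to [v] adds terms that are each at most [pair w], while the first
    [w] terms are each at least [pair w]. So the average of [pair] over the small window dominates
    every added term. *)
Lemma unimodal_centered_sum w v :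
  w%:R * \sum_(a - v <= k < a + v) f k <=
  (w + v)%:R * \sum_(a - w <= k < a + w) f k.
Proof.
rewrite !centered_sumE.
have ge0 u : 0 <= \sum_(j < u) pair j by apply: sumr_ge0.
have [vw|wv] := leqP v w.
  apply: ler_pM => //; first by rewrite ler_nat leq_addr.
  by rewrite (big_ord_widen _ pair vw) big_mkcond/= ler_sum// => i _; case: ifP.
have small : w%:R * pair w <= \sum_(j < w) pair j.
  rewrite mulr_natl -[X in _ *+ X]card_ord -sumr_const ler_sum// => i _.
  by rewrite pair_decr// ltnW.
have big : \sum_(j < v) pair j <= \sum_(j < w) pair j + v%:R * pair w.
  rewrite -(big_mkord xpredT) (big_cat_nat (n := w))//= ?(ltnW wv)// big_mkord lerD2l.
  apply: (@le_trans _ _ (\sum_(w <= j < v) pair w)).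
    by rewrite big_nat [leRHS]big_nat ler_sum// => j /andP[wj _]; rewrite pair_decr.
  by rewrite sumr_const_nat -[leLHS]mulr_natl ler_wpM2r// ler_nat leq_subr.
rewrite natrD; set S := \sum_(j < w) pair j in small big *.
apply: (le_trans (ler_wpM2l _ big)) => //.
rewrite mulrDr mulrDl lerD2l mulrCA ler_wpM2l//.
Qed.
End UnimodalSums.

(** * Binomial mass of a window around the mean *)

Section BinomialWindow.
Variables (R : realType) (x : R).
Hypotheses (x_gt0 : 0 < x) (x_lt1 : x < 1).

Lemma binomial_pmf_nneg m k : 0 <= binomial_pmf m x k.
Proof. by rewrite binomial_pmf_ge0// !ltW. Qed.

Lemma binomial_pmf_small m k : (m < k)%N -> binomial_pmf m x k = 0.
Proof. by move=> h; rewrite /binomial_pmf bin_small// mulr0n. Qed.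

Lemma binomial_pmfS0 m : binomial_pmf m.+1 x 0 = (1 - x) * binomial_pmf m x 0.
Proof.
by rewrite /binomial_pmf/= !bin0 !mulr1n !expr0 !mul1r !subn0 exprS.
Qed.

Lemma binomial_pmfSS m k :
  binomial_pmf m.+1 x k.+1 = x * binomial_pmf m x k + (1 - x) * binomial_pmf m x k.+1.
Proof.
rewrite /binomial_pmf binS mulrnDr addrC subSS; congr (_ + _).
  by rewrite exprS -mulrA -!mulrnAr.
have [km|mk] := ltnP k m; last first.
  by rewrite bin_small// !mulr0n mulr0.
by rewrite -(subnSK km) [_ ^+ (_ - _).+1]exprS mulrCA -!mulrnAr.
Qed.

(** Conditioning on one of the trials; total mass and second moment follow from this by
    induction. *)
Lemma binomial_expectationS m (phi : nat -> R) :
  \sum_(k < m.+2) binomial_pmf m.+1 x k * phi k =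
  x * (\sum_(k < m.+1) binomial_pmf m x k * phi k.+1)
  + (1 - x) * \sum_(k < m.+1) binomial_pmf m x k * phi k.
Proof.
rewrite big_ord_recl/= binomial_pmfS0.
under eq_bigr do rewrite /bump/= add1n binomial_pmfSS mulrDl.
rewrite big_split/= addrCA; congr (_ + _).
  by rewrite mulr_sumr; apply: eq_bigr => k _; rewrite mulrA.
transitivity ((1 - x) * \sum_(k < m.+2) binomial_pmf m x k * phi k).
  rewrite [in RHS]big_ord_recl/= mulrDr !mulr_sumr mulrA; congr (_ + _).
  by apply: eq_bigr => k _; rewrite mulrA.
by rewrite big_ord_recr/= binomial_pmf_small// mul0r addr0.
Qed.

(** The centre [c] is left free because the induction needs both [c] and [c - 1]. *)
Lemma binomial_second_moment m c :
  \sum_(k < m.+1) binomial_pmf m x k * (k%:R - c) ^+ 2 =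
  m%:R * x * (1 - x) + (m%:R * x - c) ^+ 2.
Proof.
elim: m c => [|m IH] c.
  by rewrite big_ord1/= /binomial_pmf/= bin0 mulr1n !expr0 !mul1r; ring.
rewrite (binomial_expectationS m (fun k => (k%:R - c) ^+ 2)) IH.
have shift k : (k.+1%:R : R) - c = k%:R - (c - 1) by rewrite -natr1; ring.
under eq_bigr do rewrite shift.
by rewrite IH -natr1; ring.
Qed.

Lemma binomial_pmf_sum1 m : \sum_(k < m.+1) binomial_pmf m x k = 1.
Proof.
elim: m => [|m IH]; first by rewrite big_ord1/= /binomial_pmf/= bin0 mulr1n !expr0 mul1r.
have := binomial_expectationS m (fun=> 1).
have e i : \sum_(k < i.+1) binomial_pmf i x k * 1 = \sum_(k < i.+1) binomial_pmf i x k.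
  by apply: eq_bigr => k _; rewrite mulr1.
by rewrite !e IH => ->; ring.
Qed.

(** The variance is at most m/4, so Chebyshev at distance sqrt m leaves at most 1/4 outside. *)
Lemma binomial_chebyshev m :
  3 / 4 <= \sum_(k < m.+1 | `|k%:R - m%:R * x| <= Num.sqrt m%:R) binomial_pmf m x k.
Proof.
have x4 : x * (1 - x) <= 1 / 4 by have := sqr_ge0 (x - 2^-1); lra.
have tail : \sum_(k < m.+1 | ~~ (`|k%:R - m%:R * x| <= Num.sqrt m%:R)) binomial_pmf m x k <= 1 / 4.
  case: m => [|m].
    rewrite big1 ?divr_ge0// => k; rewrite (ord1 k)/= mul0r subrr normr0 sqrtr0 lexx//.
  have m0 : (0 : R) < m.+1%:R by rewrite ltr0n.
  rewrite -(ler_pM2l m0); apply: (@le_trans _ _ (m.+1%:R * x * (1 - x))); last first.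
    by rewrite -mulrA ler_pM2l.
  have := binomial_second_moment m.+1 (m.+1%:R * x); rewrite subrr expr0n addr0 => <-.
  rewrite mulr_sumr big_mkcond/=; apply: ler_sum => k _.
  case: ifPn => [|_]; last by rewrite mulr_ge0 ?binomial_pmf_nneg ?sqr_ge0.
  rewrite -ltNge => h; rewrite mulrC ler_wpM2l ?binomial_pmf_nneg//.
  rewrite -[leLHS]sqr_sqrtr ?ler0n// -[leRHS]real_normK ?num_real//.
  by rewrite ler_sqr ?nnegrE ?sqrtr_ge0// ltW.
have := binomial_pmf_sum1 m.
rewrite (bigID (fun k : 'I_m.+1 => `|k%:R - m%:R * x| <= Num.sqrt m%:R))/=; lra.
Qed.

Lemma binomial_ratio m k : (k <= m)%N ->
  binomial_pmf m x k.+1 * (k.+1%:R * (1 - x)) = binomial_pmf m x k * ((m%:R - k%:R) * x).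
Proof.
move=> km; rewrite /binomial_pmf.
have [{}km|mk] := ltnP k m; last first.
  have -> : k = m by apply/eqP; rewrite eqn_leq km.
  by rewrite bin_small// mulr0n mul0r subrr mul0r mulr0.
have := congr1 (fun i : nat => i%:R : R) (mul_bin_left m k).
rewrite !natrM natrB ?(ltnW km)// => e.
rewrite (_ : m - k = (m - k.+1).+1)%N; last by lia.
rewrite -[_ *+ 'C(m, k.+1)]mulr_natr -[_ *+ 'C(m, k)]mulr_natr !exprS /unstable.onem.
transitivity (x * x ^+ k * (1 - x) ^+ (m - k.+1) * (1 - x) * (k.+1%:R * 'C(m, k.+1)%:R)); first by ring.
by rewrite e; ring.
Qed.

(** Comparison of the window of half-width [w] about the mode with Chebyshev's window of half-width
    about sqrt m, whose mass is at least 3/4. The constants 1 and 2 absorb the roundings. *)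
Lemma binomial_window m w : 3 / 4 * w%:R <= (w%:R + Num.sqrt m%:R + 2) *
  \sum_(k < m.+1 | `|k%:R - m%:R * x| <= w%:R + 1) binomial_pmf m x k.
Proof.
(* The mode: by [binomial_ratio], the mass does not decrease from k to k + 1 exactly as long as k +
   1 <= (m + 1) x. *)
pose a := Num.truncn (m.+1%:R * x).
have /andP[a1 a2] : a%:R <= m.+1%:R * x < a.+1%:R by rewrite truncn_itv// mulr_ge0// ltW.
rewrite -natr1 in a1 a2; rewrite -[a.+1%:R]natr1 in a2.
have dec k : (a <= k)%N -> binomial_pmf m x k.+1 <= binomial_pmf m x k.
  move=> ak; have [km|mk] := leqP k m; last by rewrite binomial_pmf_small ?binomial_pmf_nneg// leqW.
  have d0 : 0 < k.+1%:R * (1 - x) by rewrite mulr_gt0 ?ltr0n// subr_gt0.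
  rewrite -(ler_pM2r d0) binomial_ratio// ler_wpM2l ?binomial_pmf_nneg//.
  have : (a%:R : R) <= k%:R by rewrite ler_nat.
  by rewrite -natr1; lra.
have inc k : (k < a)%N -> binomial_pmf m x k <= binomial_pmf m x k.+1.
  move=> ka.
  have kaR : (k%:R + 1 : R) <= a%:R by rewrite natr1 ler_nat.
  have km : (k < m)%N.
    rewrite -(ltr_nat R); have : (m%:R + 1) * x < m%:R + 1 by rewrite gtr_pMr// natr1 ltr0n.
    lra.
  have d0 : 0 < k.+1%:R * (1 - x) by rewrite mulr_gt0 ?ltr0n// subr_gt0.
  rewrite -(ler_pM2r d0) binomial_ratio ?(ltnW km)// ler_wpM2l ?binomial_pmf_nneg//.
  by rewrite -natr1; lra.
(* One unit rounds sqrt m up, the other covers the distance from the mode [a] to the mean, which is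
   less than 1. *)
pose v := (Num.truncn (Num.sqrt (m%:R : R))).+2.
have /andP[v1 v2] : (Num.truncn (Num.sqrt (m%:R : R)))%:R <= Num.sqrt (m%:R : R)
    < (Num.truncn (Num.sqrt (m%:R : R))).+1%:R by rewrite truncn_itv// sqrtr_ge0.
have vE : v%:R = (Num.truncn (Num.sqrt (m%:R : R))).+1%:R + 1 :> R by rewrite natr1.
rewrite -natr1 in vE v2.
have toR u i : (a - u <= i)%N = ((a%:R : R) <= i%:R + u%:R).
  by rewrite leq_subLR addnC -natrD ler_nat.
have toR' u i : (i < a + u)%N = ((i%:R : R) < a%:R + u%:R).
  by rewrite -natrD ltr_nat.
have xl := x_lt1; have xg := x_gt0.
have outer : \sum_(k < m.+1 | `|k%:R - m%:R * x| <= Num.sqrt m%:R) binomial_pmf m x k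
    <= \sum_(a - v <= k < a + v) binomial_pmf m x k.
  pose N := (a + v + m.+1)%N.
  rewrite -(big_mkord (fun k => `|k%:R - m%:R * x| <= Num.sqrt m%:R)) (big_nat_widen _ _ N) ?leq_addl//.
  rewrite [leRHS](big_nat_widenl _ 0)// [leRHS](big_nat_widen _ _ N) ?leq_addr//.
  rewrite [leLHS]big_mkcond [leRHS]big_mkcond/=; apply: ler_sum => k _.
  case: ifPn => [/andP[]|_]; last by case: ifP => // _; exact: binomial_pmf_nneg.
  rewrite ler_norml => /andP[h1 h2]; case: ifPn => // /negP[].
  by rewrite toR toR'; apply/andP; split; lra.
have inner : \sum_(a - w <= k < a + w) binomial_pmf m x k <=
    \sum_(k < m.+1 | `|k%:R - m%:R * x| <= w%:R + 1) binomial_pmf m x k.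
  pose N := (a + w + m.+1)%N.
  rewrite -(big_mkord (fun k => `|k%:R - m%:R * x| <= w%:R + 1)) [leRHS](big_nat_widen _ _ N) ?leq_addl//.
  rewrite [leLHS](big_nat_widenl _ 0)// [leLHS](big_nat_widen _ _ N) ?leq_addr//.
  rewrite [leLHS]big_mkcond [leRHS]big_mkcond/=; apply: ler_sum => k _.
  case: ifPn => [|_]; last by case: ifP => // _; exact: binomial_pmf_nneg.
  rewrite toR toR' => /andP[h1 h2].
  case: ifPn => // /negP h; have [mk|km] := ltnP m k; first by rewrite binomial_pmf_small.
  by case: h; rewrite ltnS km ler_norml andbT; apply/andP; split; lra.
have main := unimodal_centered_sum (binomial_pmf_nneg m) inc dec w v.
have := binomial_chebyshev m => cheb.
apply: (@le_trans _ _ (w%:R * \sum_(a - v <= k < a + v) binomial_pmf m x k)).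
  by rewrite mulrC ler_wpM2l// (le_trans cheb).
apply: (le_trans main); apply: ler_pM => //.
- by apply: sumr_ge0 => k _; exact: binomial_pmf_nneg.
- by rewrite natrD; lra.
Qed.
End BinomialWindow.

(** * The number of samples in a block is binomial *)

Section HitCount.
Variables (R : realType) (n tau : nat) (B : pred 'I_n) (D : 'I_n -> R) (x : R).
Hypotheses (DB : \sum_(i | B i) D i = x) (DBc : \sum_(i | ~~ B i) D i = 1 - x).

Definition hits (s : {ffun 'I_tau -> 'I_n}) : nat := (\sum_(t < tau) B (s t))%N.

Lemma hits_le s : (hits s <= tau)%N.
Proof.
rewrite -[leqRHS]card_ord -sum1_card leq_sum// => t _; exact: leq_b1.
Qed.

(** Generating functions: ((1 - x) + x X)^tau is expanded once over samples and once by the binomial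
    theorem, and the coefficients of X^k are compared. *)
Lemma iid_law_hits k :
  \sum_(s : {ffun 'I_tau -> 'I_n} | hits s == k) iid_law D s = binomial_pmf tau x k.
Proof.
have gf : ((1 - x)%:P + x *: 'X) ^+ tau =
    \sum_(s : {ffun 'I_tau -> 'I_n}) (iid_law D s) *: 'X^(hits s).
  have -> : (1 - x)%:P + x *: 'X = \sum_(i < n) D i *: 'X^(B i).
    rewrite (bigID B)/= addrC -DBc -DB; congr (_ + _).
      rewrite raddf_sum/=; apply: eq_bigr => i /negbTE ->.
      by rewrite expr0 alg_polyC.
    by rewrite scaler_suml; apply: eq_bigr => i ->; rewrite expr1.
  rewrite -[in LHS](card_ord tau) -prodr_const bigA_distr_bigA/=.
  apply: eq_bigr => s _.
  by rewrite scaler_prod /iid_law/= prodrXr.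
have := congr1 (fun p : {poly R} => p`_k) gf.
rewrite /= exprDn !coef_sum => e.
transitivity (\sum_(s : {ffun 'I_tau -> 'I_n}) (iid_law D s *: 'X^(hits s))`_k).
  rewrite big_mkcond/=; apply: eq_bigr => s _.
  by rewrite coefZ coefXn eq_sym; case: eqP => _; rewrite ?mulr1 ?mulr0.
rewrite -e.
have coefE (i : 'I_tau.+1) : (((1 - x)%:P ^+ (tau - i) * (x *: 'X) ^+ i) *+ 'C(tau, i))`_k =
    if i == k :> nat then binomial_pmf tau x k else 0.
  rewrite coefMn -rmorphXn/= coefCM exprZn coefZ coefXn eq_sym.
  case: eqP => [->|_]; last by rewrite !mulr0 mul0rn.
  by rewrite mulr1 /binomial_pmf mulrC.
rewrite (eq_bigr _ (fun i _ => coefE i)) -big_mkcond/=.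
have [kt|tk] := leqP k tau.
  by rewrite (big_pred1 (Ordinal (kt : (k < tau.+1)%N))).
by rewrite binomial_pmf_small// big1.
Qed.

Lemma iid_law_hits_in (P : pred nat) :
  \sum_(s : {ffun 'I_tau -> 'I_n} | P (hits s)) iid_law D s =
  \sum_(k < tau.+1 | P k) binomial_pmf tau x k.
Proof.
have hlt s : (hits s < tau.+1)%N by rewrite ltnS hits_le.
rewrite (partition_big (fun s => Ordinal (hlt s)) (fun k => P k))//=.
apply: eq_bigr => k Pk; rewrite -iid_law_hits; apply: eq_bigl => s.
by rewrite -val_eqE/=; case: eqP => [->|]; rewrite ?Pk ?andbF.
Qed.
End HitCount.

(** * Two-level distributions and their likelihood ratios *)

Section BlockDistributions.
Variables (R : realType) (n b : nat).
Hypotheses (b_gt0 : (0 < b)%N) (b_ltn : (b < n)%N).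

Definition block (y : R) (i : 'I_n) : R :=
  if (i < b)%N then y / b%:R else (1 - y) / (n%:R - b%:R).

Let bR : (0 : R) < b%:R. Proof. by rewrite ltr0n. Qed.
Let nbR : (0 : R) < n%:R - b%:R. Proof. by rewrite subr_gt0 ltr_nat. Qed.
Let nR : (0 : R) < n%:R. Proof. by rewrite ltr0n (leq_trans _ b_ltn). Qed.

Lemma sum_below (c : R) : \sum_(i < n | (i < b)%N) c = b%:R * c.
Proof.
by rewrite -(big_ord_widen _ (fun=> c) (ltnW b_ltn)) sumr_const card_ord mulr_natl.
Qed.

Lemma sum_above (c : R) : \sum_(i < n | ~~ (i < b)%N) c = (n%:R - b%:R) * c.
Proof.
have : \sum_(i < n) c = n%:R * c by rewrite sumr_const card_ord mulr_natl.
by rewrite (bigID (fun i : 'I_n => (i < b)%N))/= sum_below; lra.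
Qed.

Lemma block_below y : \sum_(i < n | (i < b)%N) block y i = y.
Proof.
rewrite (eq_bigr (fun=> y / b%:R)); last by move=> i; rewrite /block => ->.
by rewrite sum_below mulrCA divff ?mulr1// gt_eqF.
Qed.

Lemma block_above y : \sum_(i < n | ~~ (i < b)%N) block y i = 1 - y.
Proof.
rewrite (eq_bigr (fun=> (1 - y) / (n%:R - b%:R))); last by move=> i; rewrite /block => /negbTE ->.
by rewrite sum_above mulrCA divff ?mulr1// gt_eqF.
Qed.

Lemma block_ge0 y i : 0 <= y <= 1 -> 0 <= block y i.
Proof.
move=> /andP[y0 y1]; rewrite /block.
by case: ifP => _; rewrite divr_ge0 ?(ltW bR) ?(ltW nbR)// subr_ge0.
Qed.

Lemma block_distr y : 0 <= y <= 1 -> is_distr (block y).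
Proof.
move=> y01; split=> [i|]; first exact: block_ge0.
by rewrite (bigID (fun i : 'I_n => (i < b)%N))/= block_below block_above; lra.
Qed.

Lemma block_uniform : block (b%:R / n%:R) = @uniform R n.
Proof.
apply/funext => i; rewrite /block /uniform; case: ifP => _; field.
  by rewrite ?gt_eqF.
by rewrite ?gt_eqF.
Qed.

Lemma TV_block y : b%:R / n%:R <= y -> TV (block y) (@uniform R n) = y - b%:R / n%:R.
Proof.
move=> yp; rewrite /TV -block_uniform (bigID (fun i : 'I_n => (i < b)%N))/=.
rewrite (eq_bigr (fun=> (y - b%:R / n%:R) / b%:R)); last first.
  move=> i ib; rewrite /block ib -mulrBl ger0_norm// divr_ge0 ?(ltW bR)//; lra.
rewrite [X in _ + X](eq_bigr (fun=> (y - b%:R / n%:R) / (n%:R - b%:R))); last first.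
  move=> i /negbTE ib; rewrite /block ib -mulrBl ler0_norm.
    by rewrite -mulNr; congr (_ / _); ring.
  by rewrite pmulr_lle0 ?invr_gt0//; lra.
rewrite sum_below sum_above; field.
by rewrite ?gt_eqF.
Qed.

Notation hits := (hits (fun i : 'I_n => (i < b)%N)).

(** The log-likelihood ratio is affine in the number of hits. Centering at tau x isolates the
    constant part, tau times the divergence of x from y, from a slope times the deviation. *)
Lemma block_likelihood tau (s : {ffun 'I_tau -> 'I_n}) x y : 0 < x < 1 -> 0 < y < 1 ->
  iid_law (block y) s = iid_law (block x) s *
    expR (- (tau%:R * (x * ln (x / y) + (1 - x) * ln ((1 - x) / (1 - y))) +
      ((hits s)%:R - tau%:R * x) * (ln (x / y) - ln ((1 - x) / (1 - y))))).
Proof.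
move=> /andP[x0 x1] /andP[y0 y1].
set u := ln (x / y); set v := ln ((1 - x) / (1 - y)).
have -> : tau%:R * (x * u + (1 - x) * v) + ((hits s)%:R - tau%:R * x) * (u - v)
    = \sum_(t < tau) (if (s t < b)%N then u else v).
  have -> : \sum_(t < tau) (if (s t < b)%N then u else v)
      = \sum_(t < tau) ((s t < b)%N%:R * (u - v) + v).
    by apply: eq_bigr => t _; case: ifP => _; rewrite /=; ring.
  rewrite big_split/= sumr_const card_ord -mulr_suml -natr_sum -mulr_natl /hits; ring.
rewrite -sumrN expR_sum -big_split/=; apply: eq_bigr => t _; rewrite /block.
have x1' : 0 < 1 - x by lra.
have y1' : 0 < 1 - y by lra.
case: ifP => _; rewrite expRN lnK ?posrE ?divr_gt0// invf_div; field;
  by rewrite ?gt_eqF.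
Qed.
End BlockDistributions.

(** * From correctness to an upper bound on the affinity *)

Lemma bernoulli_inequality (R : realFieldType) (e : R) k :
  0 <= e <= 1 -> 1 - k%:R * e <= (1 - e) ^+ k.
Proof.
move=> /andP[e0 e1]; elim: k => [|k IH]; first by rewrite mul0r expr0 subr0.
rewrite exprS; apply: le_trans (ler_wpM2l _ IH); last by lra.
have : 0 <= k%:R * e * e by rewrite !mulr_ge0.
by rewrite -natr1; lra.
Qed.

(** A minimum is at most any convex combination, here the one with weights [reject s] and
    [1 - reject s]; summing over samples gives the two error probabilities. Passing from q to q'
    doubles the second error, hence delta + 2 delta. *)
Lemma testing_affinity (R : realType) (n b : nat) (eps delta : R) (A : batch_algorithm R n) :
  (0 < b < n)%N -> 0 < eps -> b%:R / n%:R + eps < 1 -> delta_correct eps delta A ->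
  \sum_(s : {ffun 'I_(nb_samples A) -> 'I_n})
    Num.min (iid_law (@block R n b (b%:R / n%:R)) s)
            (iid_law (@block R n b (b%:R / n%:R + eps)) s) <= 3 * delta.
Proof.
move=> /andP[b0 bn] e0 q1 [errU errD].
set tau := nb_samples A in errU errD *; set p := b%:R / n%:R in q1 *.
set q := p + eps in q1 *.
have p0 : 0 <= p by rewrite divr_ge0.
(* Small enough that Bernoulli's inequality gives (1 - eta)^tau >= 1/2; the [+ 1] covers tau = 0. *)
pose eta : R := (2 * (tau%:R + 1))^-1.
have tau0 : (0 : R) <= tau%:R by [].
have eta0 : 0 < eta by rewrite invr_gt0; lra.
have eta1 : (tau%:R + 1) * eta = 1 / 2 by rewrite /eta; field; rewrite gt_eqF//; lra.
have etaT : 0 <= tau%:R * eta by rewrite mulr_ge0// ltW.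
(* Correctness only speaks of distances strictly above eps, so q itself is excluded. With this q', 1
   - q' = (1 - q)(1 - eta), so no point loses more than a factor 1 - eta. *)
pose q' := q + (1 - q) * eta.
have qq : 0 < (1 - q) * eta by rewrite mulr_gt0// subr_gt0.
have q'1 : q' < 1.
  have : (1 - q) * eta < (1 - q) * 1 by rewrite ltr_pM2l ?subr_gt0//; lra.
  by rewrite /q'; lra.
have d' : is_distr (@block R n b q') by apply: block_distr => //; rewrite /q' /q in q'1 qq *; lra.
have := errD _ d'; rewrite TV_block//; last by rewrite -/p /q' /q in qq *; lra.
rewrite -/p => /(_ _)/wrap[]; first by rewrite /q' /q in qq *; lra.
move=> err'.
have half (s : {ffun 'I_tau -> 'I_n}) : iid_law (@block R n b q) s <= 2 * iid_law (@block R n b q') s.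
  have ge0 i : 0 <= @block R n b q i by apply: block_ge0 => //; rewrite /q in q1 *; lra.
  have : (1 - eta) ^+ tau * iid_law (@block R n b q) s <= iid_law (@block R n b q') s.
    have -> : (1 - eta) ^+ tau = \prod_(t < tau) (1 - eta) by rewrite prodr_const card_ord.
    rewrite /iid_law -big_split/=.
    apply: ler_prod => t _; rewrite mulr_ge0 ?subr_ge0//=; last by lra.
    rewrite /block; case: ifP => _; last by rewrite mulrA ler_wpM2r ?invr_ge0 ?subr_ge0 ?ler_nat 1?ltnW// /q'; lra.
    rewrite mulrA ler_wpM2r ?invr_ge0//.
    have : 0 <= q * eta by rewrite mulr_ge0 ?(ltW eta0)// /q; lra.
    by rewrite /q'; lra.
  have : 1 / 2 <= (1 - eta) ^+ tau by apply: le_trans (bernoulli_inequality _ _); lra.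
  have : 0 <= iid_law (@block R n b q) s by apply: prodr_ge0.
  by move=> h1 h2; have := ler_wpM2r h1 h2; lra.
have : \sum_(s : {ffun 'I_tau -> 'I_n}) (iid_law (@block R n b p) s * reject s
    + 2 * (iid_law (@block R n b q') s * (1 - reject s))) <= 3 * delta.
  rewrite big_split/= -mulr_sumr /p block_uniform//.
  by move: errU err'; rewrite /prob_H2 /prob_H1; lra.
apply: le_trans; apply: ler_sum => s _.
have /andP[r0 r1] := reject_bound s.
set m := Num.min _ _.
have mp : m <= iid_law (@block R n b p) s by rewrite /m ge_min lexx.
have mq : m <= 2 * iid_law (@block R n b q') s by apply: le_trans (half s); rewrite /m ge_min lexx orbT.
have := ler_wpM2r r0 mp.
have r1' : 0 <= 1 - reject s by lra.
have := ler_wpM2r r1' mq.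
lra.
Qed.

(** * Estimates on Bernoulli divergences and log-likelihood slopes *)

Section Divergence.
Variable R : realType.
Implicit Types x y p q : R.

Definition klr p q : R := p * ln (p / q) + (1 - p) * ln ((1 - p) / (1 - q)).

Lemma kl_klr p q : 0 < p < 1 -> 0 < q < 1 -> kl p q = (klr p q)%:E.
Proof.
move=> /andP[p0 p1] /andP[q0 q1].
by rewrite /kl /kl_term !subr_eq0 !gt_eqF//.
Qed.

Lemma kl_1 p : 0 < p < 1 -> kl p 1 = +oo%E.
Proof.
move=> /andP[p0 p1].
by rewrite /kl /kl_term subrr eqxx oner_eq0 subr_eq0 !gt_eqF.
Qed.

Lemma ln_le_sub1 x : 0 < x -> ln x <= x - 1.
Proof.
move=> x0; have := @le_ln1Dx R (x - 1).
by rewrite addrCA subrr addr0; apply; lra.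
Qed.

Lemma ln_div_le x y : 0 < x -> 0 < y -> ln (x / y) <= (x - y) / y.
Proof.
move=> x0 y0; apply: le_trans (ln_le_sub1 (divr_gt0 x0 y0)) _.
by rewrite mulrBl divff// gt_eqF.
Qed.

Lemma ln_divC x y : 0 < x -> 0 < y -> ln (x / y) = - ln (y / x).
Proof. by move=> x0 y0; rewrite !ln_div ?posrE// opprB. Qed.

Lemma ln_div_ge0 x y : 0 < y -> y <= x -> 0 <= ln (x / y).
Proof. by move=> y0 yx; rewrite ln_ge0// ler_pdivlMr// mul1r. Qed.

(* Bounding the logarithm at the square root [s] of [(1 - q) / (1 - x)] keeps the
   second-order term that the first-order bound at [s ^+ 2] would lose. *)
Lemma klr_lower_bound x q : 0 < x -> x < q -> q < 1 ->
  (q - x) * ln ((1 - x) / (1 - q)) / 4 <= klr x q.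
Proof.
move=> x0 xq q1; set r := ln ((1 - x) / (1 - q)).
have u0 : 0 < 1 - x by lra.
have v0 : 0 < 1 - q by lra.
have q0 : 0 < q by lra.
pose s := Num.sqrt ((1 - q) / (1 - x)).
have s0 : 0 < s by rewrite sqrtr_gt0 divr_gt0.
have s2 : s ^+ 2 = (1 - q) / (1 - x) by rewrite sqr_sqrtr// ltW// divr_gt0.
have us2 : (1 - x) * s ^+ 2 = 1 - q by rewrite s2; field; rewrite gt_eqF.
have r2 : 2 * (1 - s) <= r.
  rewrite /r ln_divC// -s2 lnXn// mulr2n; have := ln_le_sub1 s0; lra.
have xlog : - (q - x) <= x * ln (x / q).
  rewrite ln_divC// mulrN lerN2 (le_trans (ler_wpM2l (ltW x0) (ln_div_le q0 x0)))//.
  by rewrite mulrCA divff ?mulr1// gt_eqF.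
have c0 : 0 <= (1 - x) - (q - x) / 4 by lra.
have := ler_wpM2l c0 r2.
have s1 : s <= 1.
  by rewrite -[leRHS]sqrtr1 ler_wsqrtr// ler_pdivrMr// mul1r; lra.
(* With q = 1 - (1 - x) s^2, the difference of the two sides is at least (1 - x)(1 - s)^3 / 2. *)
have key : 0 <= (1 - x) * ((1 - s) * (1 - s) * ((1 - s) / 2)).
  by rewrite !mulr_ge0 ?divr_ge0//; lra.
have e : ((1 - x) - (q - x) / 4) * (2 * (1 - s)) - (q - x) =
   (1 - x) * ((1 - s) * (1 - s) * ((1 - s) / 2)).
  have -> : q = 1 - (1 - x) * s ^+ 2 by rewrite us2; ring.
  by field.
rewrite /klr -/r; lra.
Qed.

Lemma ln_ratio_ge x q : 0 < x -> x < q -> q < 1 -> q - x <= ln ((1 - x) / (1 - q)).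
Proof.
move=> x0 xq q1; have u0 : 0 < 1 - x by lra.
have v0 : 0 < 1 - q by lra.
rewrite ln_divC//; have := ln_div_le v0 u0.
have : (q - x) * 1 <= (q - x) * (1 - x)^-1.
  by rewrite ler_wpM2l ?invf_ge1//; lra.
rewrite (_ : (1 - q) - (1 - x) = - (q - x)); last by ring.
rewrite mulNr; lra.
Qed.

Section Slopes.
Variables (n b : nat) (eps K : R).
Hypotheses (b_gt0 : (0 < b)%N) (b_ltn : (b < n)%N) (eps_gt0 : 0 < eps).
Let p : R := b%:R / n%:R.
Let x := p + eps / 2.
Let q := p + eps.
Hypotheses (q_lt1 : q < 1) (Kp : klr x p <= K) (Kq : klr x q <= K).

Let nR : (0 : R) < n%:R. Proof. by rewrite ltr0n (leq_trans _ b_ltn). Qed.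
Let p_ge : n%:R^-1 <= p.
Proof. by rewrite /p ler_peMl ?invr_ge0// ler1n. Qed.
Let p1_ge : n%:R^-1 <= 1 - p.
Proof.
have -> : 1 - p = (n%:R - b%:R) / n%:R by rewrite /p; field; rewrite gt_eqF.
by rewrite ler_peMl ?invr_ge0// lerBrDr nat1r ler_nat.
Qed.
Let p_gt0 : 0 < p. Proof. by apply: lt_le_trans p_ge; rewrite invr_gt0. Qed.

(** Follows from [klr_lower_bound], as the logarithm there is at least q - x = eps/2. It lets
    quantities of order eps or 1 be traded for multiples of K/eps or K/eps^2. *)
Lemma klr_max_ge : eps ^+ 2 / 16 <= K.
Proof.
apply: le_trans Kq.
have e0 := eps_gt0; have p0 := p_gt0; have q1 := q_lt1.
have x0 : 0 < x by rewrite /x; lra.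
have xq : x < q by rewrite /x /q; lra.
apply: le_trans (klr_lower_bound x0 xq q_lt1).
have h : q - x = eps / 2 by rewrite /q /x; field.
have := ln_ratio_ge x0 xq q_lt1; rewrite h => r.
have e2 : 0 <= eps / 2 by lra.
by have := ler_wpM2l e2 r; lra.
Qed.

Let eps_le : eps <= 16 * K / eps.
Proof. by rewrite ler_pdivlMr//; have := klr_max_ge; lra. Qed.

Let n_ge1 : (1 : R) <= n%:R.
Proof. by rewrite ler1n (leq_trans _ b_ltn). Qed.

Let div_le_n (c d : R) : 0 <= c -> n%:R^-1 <= d -> c / d <= c * n%:R.
Proof.
move=> c0 nd; rewrite ler_wpM2l// -[leRHS]invrK lef_pV2 ?posrE ?invr_gt0//.
by apply: lt_le_trans nd; rewrite invr_gt0.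
Qed.

(** Here p and 2 (1 - x) are both at least 1/n, so ln t <= t - 1 bounds the slope by (3/2) eps n;
    then eps <= 16 K / eps gives 24. *)
Lemma slope_low : `|ln (x / p) - ln ((1 - x) / (1 - p))| <= 24 * n%:R * K / eps.
Proof.
have e0 := eps_gt0; have p0 := p_gt0; have q1 := q_lt1.
have x0 : 0 < x by rewrite /x; lra.
have u0 : 0 < 1 - x by rewrite /x /q in q1 *; lra.
have w0 : 0 < 1 - p by rewrite /q in q1 *; lra.
rewrite (ln_divC u0 w0) opprK ger0_norm; last first.
  by rewrite addr_ge0 ?ln_div_ge0// /x; lra.
have h1 := ln_div_le x0 p_gt0; have h2 := ln_div_le w0 u0.
have e1 : (x - p) / p <= eps / 2 * n%:R.
  by rewrite (_ : x - p = eps / 2) ?div_le_n//; [lra | rewrite /x; ring].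
have e2 : (1 - p - (1 - x)) / (1 - x) <= eps * n%:R.
  have -> : (1 - p - (1 - x)) / (1 - x) = eps / (2 * (1 - x)).
    by rewrite /x; field; rewrite gt_eqF//; rewrite /x in u0; lra.
  apply: div_le_n; first exact: ltW.
  by apply: le_trans p1_ge _; rewrite /x /q in q1 *; lra.
have := ler_wpM2r (ltW nR) eps_le.
rewrite -mulrA mulrAC; lra.
Qed.

(** Since 1 - q can be arbitrarily small, ln ((1 - x) / (1 - q)) has no bound in terms of n and eps
    alone. It is bounded by 8 K / eps through [klr_lower_bound] instead. *)
Lemma slope_high : `|ln (x / q) - ln ((1 - x) / (1 - q))| <= 24 * n%:R * K / eps.
Proof.
have e0 := eps_gt0; have p0 := p_gt0; have q1 := q_lt1.
have x0 : 0 < x by rewrite /x; lra.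
have xq : x < q by rewrite /x /q; lra.
have q0 : 0 < q by lra.
have r0 : 0 <= ln ((1 - x) / (1 - q)) by rewrite ln_div_ge0//; lra.
have l0 : 0 <= ln (q / x) by rewrite ln_div_ge0// ltW.
rewrite (ln_divC x0 q0) -opprD normrN ger0_norm ?addr_ge0//.
have e1 : ln (q / x) <= eps / 2 * n%:R.
  apply: le_trans (ln_div_le q0 x0) _.
  rewrite (_ : q - x = eps / 2); last by rewrite /x /q; field.
  by apply: div_le_n; [lra | apply: le_trans p_ge _; rewrite /x; lra].
have e2 : ln ((1 - x) / (1 - q)) <= 8 * K / eps.
  rewrite ler_pdivlMr//.
  have := le_trans (klr_lower_bound x0 xq q_lt1) Kq.
  have -> : q - x = eps / 2 by rewrite /q /x; field.
  lra.
have := ler_wpM2r (ltW nR) eps_le.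
have K0 : 0 <= K / eps.
  by rewrite divr_ge0 ?(ltW eps_gt0)//; have := klr_max_ge; have := sqr_ge0 eps; lra.
have := ler_wpM2l K0 n_ge1; lra.
Qed.
End Slopes.
End Divergence.

(** * Lower bound on the affinity, and the sample complexity *)

Lemma affinity_lower_bound (R : realType) (n b tau : nat) (eps K : R) :
  let p := b%:R / n%:R in let x := p + eps / 2 in let q := p + eps in
  (0 < b < n)%N -> 0 < eps < 1 -> q < 1 -> klr x p <= K -> klr x q <= K ->
  3 / 4 * expR (- (tau%:R * K + 72 * n%:R * K / eps ^+ 2)) <=
  (4 + eps * Num.sqrt tau%:R) *
    \sum_(s : {ffun 'I_tau -> 'I_n})
      Num.min (iid_law (@block R n b p) s) (iid_law (@block R n b q) s).
Proof.
move=> p x q /andP[b0 bn] /andP[e0 e1] q1 Kp Kq.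
have K0 := klr_max_ge b0 bn e0 q1 Kq.
have Kpos : 0 <= K by have := sqr_ge0 eps; lra.
have nR : (0 : R) < n%:R by rewrite ltr0n (leq_trans _ bn).
have p0 : 0 < p by rewrite divr_gt0// ltr0n.
have x0 : 0 < x by rewrite /x; lra.
have x1 : x < 1 by rewrite /x /q in q1 *; lra.
pose a := 24 * n%:R * K / eps.
have a0 : 0 <= a by rewrite !mulr_ge0 ?invr_ge0// ltW.
(* The least integer above 1/eps. Then eps (w + 1) <= 3, which turns the slope constant 24 into 72,
   and eps (w + 2) <= 4, which gives the 4 in the prefactor. *)
pose w := (Num.truncn eps^-1).+1.
have ei0 : 0 <= eps^-1 by rewrite invr_ge0 ltW.
have /andP[w1 w2] := truncn_itv ei0.
have ew1 : 1 <= eps * w%:R.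
  by have := ler_wpM2l (ltW e0) (ltW w2); rewrite divff// gt_eqF.
have ew2 : eps * w%:R <= 1 + eps.
  have := ler_wpM2l (ltW e0) w1; rewrite divff ?gt_eqF//.
  by rewrite /w -natr1; lra.
pose E := tau%:R * K + 72 * n%:R * K / eps ^+ 2.
set B := (fun i : 'I_n => (i < b)%N).
have likely (s : {ffun 'I_tau -> 'I_n}) :
    `|(hits B s)%:R - tau%:R * x| <= w%:R + 1 ->
    iid_law (@block R n b x) s * expR (- E) <=
    Num.min (iid_law (@block R n b p) s) (iid_law (@block R n b q) s).
  move=> hs.
  have ge0 : 0 <= iid_law (@block R n b x) s.
    by apply: prodr_ge0 => t _; rewrite block_ge0//; lra.
  have aw : a * (w%:R + 1) <= 72 * n%:R * K / eps ^+ 2.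
    have -> : 72 * n%:R * K / eps ^+ 2 = a * (3 / eps) by rewrite /a; field; rewrite gt_eqF.
    by rewrite ler_wpM2l// ler_pdivlMr//; lra.
  have dev (c : R) : `|c| <= a -> ((hits B s)%:R - tau%:R * x) * c <= a * (w%:R + 1).
    move=> ca; apply: le_trans (ler_norm _) _; rewrite normrM mulrC.
    exact: ler_pM.
  have bound y : 0 < y < 1 -> klr x y <= K ->
      `|ln (x / y) - ln ((1 - x) / (1 - y))| <= a ->
      iid_law (@block R n b x) s * expR (- E) <= iid_law (@block R n b y) s.
    move=> y01 Ky sl; rewrite (@block_likelihood R n b b0 bn tau s x y) ?x0//.
    rewrite ler_wpM2l// ler_expR lerN2 lerD//; first by rewrite ler_wpM2l.
    exact: le_trans (dev _ sl) aw.
  rewrite le_min !bound//.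
  - by rewrite /q in q1 *; apply/andP; split; lra.
  - exact: slope_high.
  - by rewrite /q in q1 *; apply/andP; split; lra.
  - exact: (slope_low b0 bn e0 q1 Kq).
pose W := \sum_(k < tau.+1 | `|k%:R - tau%:R * x| <= w%:R + 1) binomial_pmf tau x k.
have W0 : 0 <= W by apply: sumr_ge0 => k _; rewrite binomial_pmf_ge0// !ltW.
have WE : W * expR (- E) <= \sum_(s : {ffun 'I_tau -> 'I_n})
    Num.min (iid_law (@block R n b p) s) (iid_law (@block R n b q) s).
  have DB := @block_below R n b b0 bn x; have DBc := @block_above R n b bn x.
  rewrite /W -(iid_law_hits_in tau DB DBc (fun k => `|k%:R - tau%:R * x| <= w%:R + 1)).
  rewrite mulr_suml big_mkcond/=; apply: ler_sum => s _.
  case: ifPn => [|_]; first exact: likely.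
  have pq : p < q by rewrite /q; lra.
  by rewrite le_min; apply/andP; split; apply: prodr_ge0 => t _; rewrite block_ge0//; lra.
apply: le_trans (ler_wpM2l _ WE); last first.
  by rewrite addr_ge0// mulr_ge0 ?sqrtr_ge0// ltW.
rewrite mulrA ler_wpM2r ?expR_ge0//.
have win := binomial_window x0 x1 tau w; rewrite -/W in win.
have := ler_wpM2l (ltW e0) win.
have W3 : eps * ((w%:R + Num.sqrt tau%:R + 2) * W) <= (4 + eps * Num.sqrt tau%:R) * W.
  by rewrite mulrA ler_wpM2r//; lra.
by move=> h; lra.
Qed.

(** Taking logarithms in the two affinity bounds gives L <= tau K + 72 n K / eps^2 + 32 M. As K >=
    eps^2/16, 32 M is at most 512 M K / eps^2, and 584 = 72 + 512. *)
Lemma nb_samples_lower_bound (R : realType) (n b : nat) (eps delta K : R)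
    (A : batch_algorithm R n) :
  let p := b%:R / n%:R in let x := p + eps / 2 in let q := p + eps in
  (0 < b < n)%N -> 0 < eps < 1 -> q < 1 -> 0 < delta < 1 -> delta_correct eps delta A ->
  klr x p <= K -> klr x q <= K ->
  0 < K /\ ln delta^-1 / K <= (nb_samples A)%:R + 584 * remainder n eps delta.
Proof.
move=> p x q b0n e01 q1 d01 corr Kp Kq.
have /andP[b0 bn] := b0n; have /andP[e0 e1] := e01; have /andP[d0 d1] := d01.
have K16 := klr_max_ge b0 bn e0 q1 Kq.
have esq : 0 < eps ^+ 2 by rewrite exprn_gt0.
have K0 : 0 < K by lra.
split=> //; rewrite ler_pdivrMr// /remainder.
set tau := nb_samples A; set M := Num.max 1 _; set L := ln delta^-1 in M *.
have L0 : 0 < L by rewrite ln_gt0// invf_gt1.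
have M1 : 1 <= M by rewrite /M le_max lexx.
have n1 : (1 : R) <= n%:R by rewrite ler1n (leq_trans _ bn).
have nM : 0 <= 584 * (n%:R * M / eps ^+ 2).
  apply: mulr_ge0; first exact: ler0n.
  by apply: divr_ge0; [apply: mulr_ge0; lra | exact: ltW].
(* If tau K > L the claim is immediate. Otherwise K >= eps^2/16 bounds eps sqrt tau by 4 sqrt L,
   hence by 4 exp M. *)
have [tauL|Ltau] := leP (tau%:R * K) L; last first.
  by rewrite mulrDl; have := mulr_ge0 nM (ltW K0); lra.
have low := affinity_lower_bound tau b0n e01 q1 Kp Kq.
have up := testing_affinity b0n e0 q1 corr.
rewrite -/p -/q -/tau in low up.
set E := tau%:R * K + 72 * n%:R * K / eps ^+ 2 in low.
have st0 : 0 <= Num.sqrt (tau%:R : R) by rewrite sqrtr_ge0.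
have es0 : 0 <= eps * Num.sqrt tau%:R by rewrite mulr_ge0// ltW.
have LM : L <= expR M by rewrite -[leLHS]lnK ?posrE// ler_expR /M le_max lexx orbT.
have eM1 : 1 <= expR M by have := expR_ge1Dx M; lra.
have sL : Num.sqrt L <= expR M.
  have := sqr_ge0 (Num.sqrt L - 1); have := sqr_sqrtr (ltW L0); lra.
have eL : eps * Num.sqrt tau%:R <= 4 * Num.sqrt L.
  rewrite -ler_sqr ?nnegrE ?mulr_ge0 ?sqrtr_ge0 ?(ltW e0)// !exprMn !sqr_sqrtr ?(ltW L0)//.
  have t0 : (0 : R) <= tau%:R by [].
  have := ler_wpM2l t0 K16; lra.
have small : expR (- E) <= delta * (32 * expR M).
  have c0 : 0 <= 4 + eps * Num.sqrt tau%:R by lra.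
  have h1 := le_trans low (ler_wpM2l c0 up).
  have h2 : (4 + eps * Num.sqrt tau%:R) * delta <= (8 * expR M) * delta.
    by rewrite ler_wpM2r ?(ltW d0)//; lra.
  lra.
have LE : L <= E + 32 * M.
  have eM0 := expR_gt0 M.
  have : ln (expR (- E)) <= ln (delta * (32 * expR M)).
    by rewrite ler_ln// posrE ?expR_gt0// !mulr_gt0.
  rewrite !lnM ?posrE ?mulr_gt0// !expRK.
  have d32 : (0 : R) < 32 by [].
  (* ln 32 <= 31, and 31 + M <= 32 M because M >= 1. *)
  have := ln_le_sub1 d32; rewrite /L lnV ?posrE//; lra.
apply: (le_trans LE).
have k1 : 32 * M <= 512 * M * (K / eps ^+ 2).
  have : 16^-1 <= K / eps ^+ 2 by rewrite ler_pdivlMr//; lra.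
  move=> h; have M512 : 0 <= 512 * M by lra.
  have := ler_wpM2l M512 h; lra.
have Ke0 : 0 <= K / eps ^+ 2 by rewrite divr_ge0 ?ltW.
have k2 : M * (K / eps ^+ 2) <= n%:R * M * (K / eps ^+ 2).
  by rewrite ler_wpM2r// ler_peMl//; lra.
have k3 : n%:R * (K / eps ^+ 2) <= n%:R * M * (K / eps ^+ 2).
  by rewrite ler_wpM2r// ler_peMr//; lra.
rewrite /E; lra.
Qed.

Theorem theorem1 (R : realType) :
  exists2 C : R, 0 < C &
    forall (n : nat) (eps delta : R) (A : batch_algorithm R n),
      (2 <= n)%N -> 0 < eps < 1 -> 0 < delta < 1 ->
      delta_correct eps delta A ->
      (main_term n eps delta - (C * remainder n eps delta)%:E
         <= (nb_samples A)%:R%:E)%E.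
Proof.
exists 584; first by rewrite ltr0n.
move=> n eps delta A n2 e01 d01 corr.
have /andP[e0 e1] := e01; have /andP[d0 d1] := d01.
have nR : (0 : R) < n%:R by rewrite ltr0n (leq_trans _ n2).
have rem0 : 0 <= remainder n eps delta.
  by rewrite /remainder !mulr_ge0 ?invr_ge0 ?sqr_ge0 ?(ltW nR)// le_max ler01.
rewrite leeBlDr// -EFinD /main_term big_nat_cond.
apply: bigmax_le => [|b /andP[/andP[b0 _] q_le]]; first exact: leNye.
set p := b%:R / n%:R in q_le *.
have p0 : 0 < p by rewrite divr_gt0// ltr0n.
have bn : (b < n)%N.
  by rewrite -(ltr_nat R) -[ltRHS]mul1r -ltr_pdivrMr// -/p; lra.
have x01 : 0 < p + eps / 2 < 1 by apply/andP; split; lra.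
(* At p + eps = 1 the first quotient is 0, so the minimum is at most 0. *)
have [q1|q1] := eqVneq (p + eps) 1.
  rewrite q1 (kl_1 x01) ge_min invey mule0 lee_fin; apply/orP; left.
  apply: addr_ge0; first exact: ler0n.
  by apply: mulr_ge0; [exact: ler0n | exact: rem0].
have {q1}q_lt : p + eps < 1 by rewrite lt_neqAle q1.
have q01 : 0 < p + eps < 1 by apply/andP; split; lra.
have p01 : 0 < p < 1 by apply/andP; split; lra.
have b0n : (0 < b < n)%N by rewrite b0.
rewrite !kl_klr// ge_min.
(* K is the larger divergence; bounding the quotient by K suffices for the minimum. *)
have [le|/ltW le] := leP (klr (p + eps / 2) p) (klr (p + eps / 2) (p + eps)).
  have [K0 bnd] := nb_samples_lower_bound b0n e01 q_lt d01 corr le (lexx _).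
  by rewrite inver gt_eqF// -EFinM lee_fin bnd.
have [K0 bnd] := nb_samples_lower_bound b0n e01 q_lt d01 corr (lexx _) le.
by rewrite !inver (gt_eqF K0) -!EFinM !lee_fin bnd orbT.
Qed.
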